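(* Let $A,B$ be two groups and $G$ a finitely presented group. Assume that $A$ is non-trivial and that $B$ is infinite. If $G$ admits $A \wr B$ as a quotient, then $G$ is SQ-universal.
   Context: $A \wr B := \bigoplus_B A \rtimes B$ is the restricted wreath product, $B$ acting on $\bigoplus_B A$ by permuting the coordinates through left multiplication on $B$. A group $G$ is SQ-universal if every countable group is isomorphic to a subgroup of some quotient of $G$. *)

(* Defs.v *)
From HB Require Import structures.
From mathcomp Require Import all_boot finmap.
From mathcomp Require Import boolp classical_sets functions cardinality.

Set Implicit Arguments.
Unset Strict Implicit.
Unset Printing Implicit Defensive.

Local Open Scope classical_set_scope.
Local Open Scope fset_scope.
Local Open Scope group_scope.

Definition surjective (X Y : Type) (f : X -> Y) : Prop :=
  forall y, exists x, f x = y.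

Definition is_quotient (G Q : groupType) : Prop :=
  exists p : {multiplicative G -> Q}, surjective p.

Definition is_subgroup (H Q : groupType) : Prop :=
  exists i : {multiplicative H -> Q}, injective i.

(* [countable] includes the finite case. *)
Definition SQ_universal (G : groupType) : Prop :=
  forall H : groupType, countable [set: H] ->
  exists2 Q : groupType, is_quotient G Q & is_subgroup H Q.

(* The free group on [T]: reduced words in the letters [(x, false)], standing
   for the generator [x], and [(x, true)], standing for its inverse. *)
Section FreeGroup.
Variable T : choiceType.
Implicit Types (a b : T * bool) (u v w : seq (T * bool)).

Definition letter_inv a : T * bool := (a.1, ~~ a.2).

Definition reduced u : bool := sorted (fun a b => b != letter_inv a) u.

Record free_group := FreeGroup { free_word : seq (T * bool);
                                 free_wordP : reduced free_word }.

HB.instance Definition _ := [isSub for free_word].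
HB.instance Definition _ := [Choice of free_group by <:].

Definition push a u :=
  if u is b :: u' then if b == letter_inv a then u' else a :: u else [:: a].

Definition word_mul u v := foldr push v u.
Definition word_inv u := rev (map letter_inv u).

Lemma letter_invK : involutive letter_inv.
Proof. by case=> x e; rewrite /letter_inv /= negbK. Qed.

Lemma reduced_push a u : reduced u -> reduced (push a u).
Proof.
case: u => //= b u; case: ifPn => [_ /path_sorted //|ba] ru.
by rewrite /reduced /= ba.
Qed.

Lemma reduced_mul u v : reduced v -> reduced (word_mul u v).
Proof. by move=> rv; elim: u => //= a u; apply: reduced_push. Qed.

Lemma reduced_inv u : reduced u -> reduced (word_inv u).
Proof.
rewrite /reduced /word_inv rev_sorted sorted_map; apply: sub_sorted => a b /=.
by apply: contraNneq => ->; rewrite !letter_invK.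
Qed.

Lemma pushK a u : reduced u -> push a (push (letter_inv a) u) = u.
Proof.
case: u => [|b u] /=; first by rewrite eqxx.
rewrite letter_invK; case: eqP => [->|_ _] /=; last by rewrite eqxx.
by case: u => //= c u /andP[/negPf->].
Qed.

Lemma word_mul_push a u v :
  reduced v -> word_mul (push a u) v = push a (word_mul u v).
Proof.
case: u => //= b u rv; case: eqP => //= ->.
by rewrite pushK //; apply: reduced_mul.
Qed.

Lemma word_mulA u v w :
  reduced w -> word_mul u (word_mul v w) = word_mul (word_mul u v) w.
Proof. by move=> rw; elim: u => //= a u ->; rewrite word_mul_push. Qed.

Lemma word_mul1 u : reduced u -> word_mul u [::] = u.
Proof.
elim: u => //= a u IHu ru; rewrite IHu; last exact: path_sorted ru.
by case: u ru {IHu} => //= b u /andP[/negPf->].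
Qed.

Lemma word_mulV u : word_mul (word_inv u) u = [::].
Proof.
rewrite /word_mul /word_inv; elim: u => //= a u IHu.
by rewrite rev_cons foldr_rcons /= letter_invK eqxx.
Qed.

Definition free_one := FreeGroup (erefl : reduced [::]).
Definition free_mul (x y : free_group) :=
  FreeGroup (reduced_mul (free_word x) (free_wordP y)).
Definition free_inv (x : free_group) := FreeGroup (reduced_inv (free_wordP x)).

Lemma free_mulA : associative free_mul.
Proof. by move=> x y z; apply: val_inj; apply/word_mulA/free_wordP. Qed.

Lemma free_mul1g : left_id free_one free_mul.
Proof. by move=> x; apply: val_inj. Qed.

Lemma free_mulg1 : right_id free_one free_mul.
Proof. by move=> x; apply: val_inj; apply/word_mul1/free_wordP. Qed.

Lemma free_mulVg : left_inverse free_one free_inv free_mul.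
Proof. by move=> x; apply: val_inj; apply: word_mulV. Qed.

Lemma free_mulgV : right_inverse free_one free_inv free_mul.
Proof.
move=> x; rewrite -[x in free_mul x]free_mul1g.
rewrite -{1}(free_mulVg (free_inv x)) -!free_mulA.
by rewrite [free_mul (free_inv x) _]free_mulA free_mulVg free_mul1g free_mulVg.
Qed.

HB.instance Definition _ := isGroup.Build free_group
  free_mulA free_mul1g free_mulg1 free_mulVg free_mulgV.

End FreeGroup.

Section NormalClosure.
Variable G : groupType.

Definition normal_subgroup (N : set G) : Prop :=
  [/\ N 1, forall x y, N x -> N y -> N (x * y), forall x, N x -> N x^-1
    & forall x y, N x -> N (x ^ y)].

Definition normal_closure (S : set G) : set G := smallest normal_subgroup S.

End NormalClosure.

Definition finitely_presented (G : groupType) : Prop :=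
  exists (n : nat) (rels : seq (free_group 'I_n))
         (f : {multiplicative free_group 'I_n -> G}),
    surjective f /\ [set w | f w = 1] = normal_closure [set` rels].

Section DirectSum.
Variables (A : groupType) (I : choiceType).

(* Finitely supported families in [A] indexed by [I]. *)
Definition direct_sum := {fsfun I -> A with 1}.

HB.instance Definition _ := Choice.on direct_sum.
Implicit Types f g : direct_sum.

Definition dsum_one : direct_sum := [fsfun with 1].
Definition dsum_mul f g : direct_sum :=
  [fsfun x in finsupp f `|` finsupp g => f x * g x].
Definition dsum_inv f : direct_sum := [fsfun x in finsupp f => (f x)^-1].

Lemma dsum_oneE x : dsum_one x = 1.
Proof. exact: fsfun0E. Qed.

Lemma dsum_mulE f g x : dsum_mul f g x = f x * g x.
Proof.
rewrite fsfunE inE; case: (finsuppP f x) => //= _.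
by case: (finsuppP g x) => //= _; rewrite mulg1.
Qed.

Lemma dsum_invE f x : dsum_inv f x = (f x)^-1.
Proof. by rewrite fsfunE; case: (finsuppP f x) => //= _; rewrite invg1. Qed.

Lemma dsum_mulA : associative dsum_mul.
Proof. by move=> f g h; apply/fsfunP=> x; rewrite !dsum_mulE mulgA. Qed.

Lemma dsum_mul1g : left_id dsum_one dsum_mul.
Proof. by move=> f; apply/fsfunP=> x; rewrite dsum_mulE dsum_oneE mul1g. Qed.

Lemma dsum_mulg1 : right_id dsum_one dsum_mul.
Proof. by move=> f; apply/fsfunP=> x; rewrite dsum_mulE dsum_oneE mulg1. Qed.

Lemma dsum_mulVg : left_inverse dsum_one dsum_inv dsum_mul.
Proof.
by move=> f; apply/fsfunP=> x; rewrite dsum_mulE dsum_invE dsum_oneE mulVg.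
Qed.

Lemma dsum_mulgV : right_inverse dsum_one dsum_inv dsum_mul.
Proof.
by move=> f; apply/fsfunP=> x; rewrite dsum_mulE dsum_invE dsum_oneE mulgV.
Qed.

HB.instance Definition _ := isGroup.Build direct_sum
  dsum_mulA dsum_mul1g dsum_mulg1 dsum_mulVg dsum_mulgV.

End DirectSum.

Section Wreath.
Variables A B : groupType.
Implicit Types (b c : B) (f g : direct_sum A B).

(* The coordinate of [f] at [y] becomes the coordinate of [dsum_shift b f] at
   [b * y], see [dsum_shiftE]. *)
Definition dsum_shift b f : direct_sum A B :=
  [fsfun x in [fset b * y | y in finsupp f] => f (b^-1 * x)].

Lemma dsum_shiftE b f x : dsum_shift b f x = f (b^-1 * x).
Proof.
rewrite fsfunE; case: ifPn => //; apply: contraNeq => fx.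
by apply/imfsetP; exists (b^-1 * x); rewrite ?mulVKg //= mem_finsupp eq_sym.
Qed.

Lemma dsum_shift1 f : dsum_shift 1 f = f.
Proof. by apply/fsfunP=> x; rewrite dsum_shiftE invg1 mul1g. Qed.

Lemma dsum_shiftD b c f : dsum_shift (b * c) f = dsum_shift b (dsum_shift c f).
Proof. by apply/fsfunP=> x; rewrite !dsum_shiftE invgM mulgA. Qed.

Lemma dsum_shiftM b f g : dsum_shift b (f * g) = dsum_shift b f * dsum_shift b g.
Proof. by apply/fsfunP=> x; rewrite dsum_shiftE !dsum_mulE !dsum_shiftE. Qed.

Lemma dsum_shift_one b : dsum_shift b 1 = 1.
Proof. by apply/fsfunP=> x; rewrite dsum_shiftE !dsum_oneE. Qed.

Record wreath := Wreath { wr_base : direct_sum A B; wr_top : B }.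

Definition pair_of_wreath (w : wreath) := (wr_base w, wr_top w).
Definition wreath_of_pair (p : direct_sum A B * B) := Wreath p.1 p.2.

Lemma pair_of_wreathK : cancel pair_of_wreath wreath_of_pair.
Proof. by case. Qed.

HB.instance Definition _ := Choice.copy wreath (can_type pair_of_wreathK).
Implicit Types u v w : wreath.

Definition wr_one := Wreath 1 1.
Definition wr_mul u v :=
  Wreath (wr_base u * dsum_shift (wr_top u) (wr_base v)) (wr_top u * wr_top v).
Definition wr_inv u :=
  Wreath (dsum_shift (wr_top u)^-1 (wr_base u)^-1) (wr_top u)^-1.

Lemma wr_mulA : associative wr_mul.
Proof.
by move=> u v w; rewrite /wr_mul /= dsum_shiftM dsum_shiftD !mulgA.
Qed.

Lemma wr_mul1g : left_id wr_one wr_mul.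
Proof. by case=> f b; rewrite /wr_mul /= dsum_shift1 !mul1g. Qed.

Lemma wr_mulg1 : right_id wr_one wr_mul.
Proof. by case=> f b; rewrite /wr_mul /= dsum_shift_one !mulg1. Qed.

Lemma wr_mulVg : left_inverse wr_one wr_inv wr_mul.
Proof.
by case=> f b; rewrite /wr_mul /= -dsum_shiftM !mulVg dsum_shift_one.
Qed.

Lemma wr_mulgV : right_inverse wr_one wr_inv wr_mul.
Proof.
by case=> f b; rewrite /wr_mul /= -dsum_shiftD !mulgV dsum_shift1 mulgV.
Qed.

HB.instance Definition _ := isGroup.Build wreath
  wr_mulA wr_mul1g wr_mulg1 wr_mulVg wr_mulgV.

End Wreath.

(* Main.v *)
Require Import Defs.
From HB Require Import structures.
From mathcomp Require Import all_boot finmap.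
From mathcomp Require Import ssralg ssrnum ssrint zify.
From mathcomp Require Import boolp classical_sets functions cardinality.

(** Finite presentability reduces the statement to a construction of
    permutations.  Let K be any group, with morphisms alpha : A -> K and
    beta : B -> K.  They extend to A wr B as soon as alpha(A) commutes with
    alpha(A) ^ beta(c) for every c <> 1 in B.  For a finite list F, ask for this
    only when c is in F.  The formula that should define the extension
    ([wr_lift]) still makes sense, and it respects any given finite set of
    products once F is large enough ([wr_liftM]).  Now the composite G -> A wr B
    is determined by finitely many generators and only finitely many relators
    have to be killed; so, for F large enough, every pair (alpha, beta) subject
    to the commutations in F gives a morphism theta : G -> K, whose image
    contains beta(B) and alpha(a) for one chosen a <> 1
    ([finitely_presented_lift]).  It remains, for a countable group H, to choose
    K, alpha and beta so that the image of theta contains a copy of H; that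
    image is the wanted quotient.

    Take K = Sym(B * X), let B permute the fibres X by left multiplication, and
    let A preserve each fibre: it acts on the fibre over t_m through a morphism
    A -> Sym(X) depending on m, and trivially on the fibres over other points,
    where t_0, t_1, ... is a sequence in the infinite group B.  Commutation for
    c in F holds when no t_k is c t_l.  Conjugating alpha(a) by beta(t_i) brings
    the i-th action of a over the point 1, together with noise over other
    points.  If t_m is never of the form t_p t_q^-1 t_r with p, q, r < m, then
    commutators of length three of such conjugates carry no noise
    ([generic_translate], [translate_commg]).  Commutators of length two would
    not do: when b = t_i^-1 t_j is an involution, the i-th and the j-th
    conjugates exchange their roles over b.

    So it is enough to find X, and for each h in H some morphisms A -> Sym(X),
    such that a triple commutator in the images of a is a copy of h.  This is
    done in two stages.  First, in Sym(Z * H), the commutator of two reflections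
    of Z is a translation by 2, and the commutator of this translation with the
    action of h on the nonnegative fibres is the action of h on two fibres
    ([lmul_triple_commg]): every h becomes a triple commutator [[d1, d2], d3].
    Secondly, each d_i is replaced by x_i^-1 x_i ^ d_i, where x_i is the
    image of a in an action of A on copies of Z * H and d_i lives on one copy.
    This is d_i together with an error on another copy, and the x_i are chosen
    so that the errors disappear from the triple commutator
    ([at_unit_commg]). *)

Set Implicit Arguments.
Unset Strict Implicit.
Unset Printing Implicit Defensive.

Local Open Scope group_scope.

(** * Group morphisms *)

Section Morphisms.
Variables (G K : groupType) (f : {multiplicative G -> K}).

Lemma morph1 : f 1 = 1.
Proof. by apply: (mulgI (f 1)); rewrite -gmulfM !mulg1. Qed.

Lemma morphV x : f x^-1 = (f x)^-1.
Proof. by apply/esym/mulg1_eq; rewrite -gmulfM mulgV morph1. Qed.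

Lemma morphJ x y : f (x ^ y) = f x ^ f y.
Proof. by rewrite !gmulfM morphV. Qed.

Lemma morphR x y : f [~ x, y] = [~ f x, f y].
Proof. by rewrite !gmulfM !morphV. Qed.

End Morphisms.

Lemma commuteJ (G : groupType) (x y z : G) :
  commute x y -> commute (x ^ z) (y ^ z).
Proof. by rewrite /commute -!conjMg => ->. Qed.

Section ConjugateMorphism.
Variables (G K : groupType) (f : {multiplicative G -> K}) (k : K).

Definition conj_morph x := f x ^ k.

Lemma conj_morphM : {morph conj_morph : x y / x * y}.
Proof. by move=> x y; rewrite /conj_morph gmulfM conjMg. Qed.

HB.instance Definition _ := isMultiplicative.Build G K conj_morph conj_morphM.

End ConjugateMorphism.

(** * Symmetric groups *)

Section SymmetricGroup.
Variable X : Type.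

Record sym := Sym {
  sym_fun :> X -> X;
  sym_inv : X -> X;
  sym_funK : cancel sym_fun sym_inv;
  sym_invK : cancel sym_inv sym_fun }.

Implicit Types s t u : sym.

Lemma symP s t : s =1 t -> s = t.
Proof.
case: s t => [f f' fK f'K] [g g' gK g'K] /= /funext fg.
move: gK g'K; rewrite -{}fg => gK g'K.
have fg : f' = g' by apply/funext => x; rewrite -{2}[x]f'K gK.
move: gK g'K; rewrite -{}fg => gK g'K.
by congr Sym; apply: Prop_irrelevance.
Qed.

HB.instance Definition _ := gen_eqMixin sym.
HB.instance Definition _ := gen_choiceMixin sym.

Definition sym_one := @Sym id id (fun=> erefl) (fun=> erefl).
Definition sym_mul s t :=
  Sym (can_comp (sym_funK s) (sym_funK t)) (can_comp (sym_invK t) (sym_invK s)).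
Definition sym_opp s := Sym (sym_invK s) (sym_funK s).

Lemma sym_mulA : associative sym_mul.
Proof. by move=> s t u; apply: symP. Qed.
Lemma sym_mul1g : left_id sym_one sym_mul.
Proof. by move=> s; apply: symP. Qed.
Lemma sym_mulg1 : right_id sym_one sym_mul.
Proof. by move=> s; apply: symP. Qed.
Lemma sym_mulVg : left_inverse sym_one sym_opp sym_mul.
Proof. by move=> s; apply: symP => x; apply: sym_funK. Qed.
Lemma sym_mulgV : right_inverse sym_one sym_opp sym_mul.
Proof. by move=> s; apply: symP => x; apply: sym_invK. Qed.

HB.instance Definition _ := isGroup.Build sym
  sym_mulA sym_mul1g sym_mulg1 sym_mulVg sym_mulgV.

Lemma symME s t x : (s * t) x = s (t x). Proof. by []. Qed.

End SymmetricGroup.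

Section Regular.
Variable G : groupType.

Definition lmul (g : G) : sym G := Sym (mulKg g) (mulVKg g).

Lemma lmulM : {morph lmul : x y / x * y}.
Proof. by move=> x y; apply: symP => z /=; rewrite mulgA. Qed.

HB.instance Definition _ := isMultiplicative.Build G (sym G) lmul lmulM.

Lemma lmul_inj : injective lmul.
Proof. by move=> x y /(congr1 (fun s => sym_fun s 1)) /=; rewrite !mulg1. Qed.

End Regular.

(** * Permutations of a product *)

(** [fib] and [base] generate the unrestricted wreath product of Sym(X) by
    Sym(I), in its imprimitive action; all the groups of permutations below
    arise by iterating this. *)
Section Product.
Variables I X : Type.
Implicit Types (p q : I -> sym X) (s t : sym I) (P : pred I).

Lemma fib_subproof p q : (forall i, p i * q i = 1) ->
  cancel (fun z : I * X => (z.1, q z.1 z.2)) (fun z => (z.1, p z.1 z.2)).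
Proof. by move=> pq [i x] /=; rewrite -symME pq. Qed.

Definition fib p : sym (I * X) :=
  Sym (fib_subproof (fun i => mulVg (p i)))
      (fib_subproof (fun i => mulgV (p i))).

Lemma eq_fib p q : p =1 q -> fib p = fib q.
Proof. by move/funext->. Qed.

Lemma fibM p q : fib p * fib q = fib (fun i => p i * q i).
Proof. by apply: symP. Qed.

Lemma fibV p : (fib p)^-1 = fib (fun i => (p i)^-1).
Proof. by apply: symP. Qed.

Lemma fibR p q : [~ fib p, fib q] = fib (fun i => [~ p i, q i]).
Proof. by rewrite /commg /conjg !fibV !fibM. Qed.

Lemma fib_inj p q : fib p = fib q -> p =1 q.
Proof.
move=> pq i; apply: symP => x.
by have := congr1 (fun f : sym (I * X) => (f (i, x)).2) pq.
Qed.

Lemma fib_commute p q :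
  (forall i, commute (p i) (q i)) -> commute (fib p) (fib q).
Proof. by move=> pq; rewrite /commute !fibM; apply: eq_fib => i; apply: pq. Qed.

Lemma base_subproof s t : s * t = 1 ->
  cancel (fun z : I * X => (t z.1, z.2)) (fun z => (s z.1, z.2)).
Proof. by move=> st [i x] /=; rewrite -symME st. Qed.

Definition base s : sym (I * X) :=
  Sym (base_subproof (mulVg s)) (base_subproof (mulgV s)).

Lemma baseM : {morph base : s t / s * t}.
Proof. by move=> s t; apply: symP. Qed.

HB.instance Definition _ :=
  isMultiplicative.Build (sym I) (sym (I * X)) base baseM.

Lemma fibJ p s : fib p ^ base s = fib (fun i => p (s i)).
Proof. by apply: symP => -[i x] /=; rewrite sym_funK. Qed.

Lemma base_commR s p : [~ base s, fib p] = fib (fun i => (p (s i))^-1 * p i).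
Proof. by rewrite commgEr fibV fibJ fibM. Qed.

Definition fib_on P (x : sym X) : sym (I * X) :=
  fib (fun i => if P i then x else 1).

Lemma fib_onM P : {morph fib_on P : x y / x * y}.
Proof.
move=> x y; rewrite /fib_on fibM; apply: eq_fib => i.
by case: ifP; rewrite ?mulg1.
Qed.

HB.instance Definition _ P :=
  isMultiplicative.Build (sym X) (sym (I * X)) (fib_on P) (fib_onM P).

Lemma fib_on_inj P i : P i -> injective (fib_on P).
Proof. by move=> Pi x y /fib_inj/(_ i); rewrite Pi. Qed.

End Product.

(** * Group elements as triple commutators of permutations *)

Lemma reflectionK (c : int) : involutive (fun n => c - n)%R.
Proof. by move=> n /=; lia. Qed.

Definition reflection (c : int) : sym int :=
  Sym (reflectionK c) (reflectionK c).

Definition nonneg_int : pred int := fun n => (0 <= n)%R.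
Definition first_two_int : pred int := fun n => (0 <= n < 2)%R.

Lemma reflection_commg (n : int) : [~ reflection 0, reflection 1] n = (n - 2)%R.
Proof. by rewrite /= ; lia. Qed.

(** The commutator of the two reflections is the translation by -2, and
    conjugating by it moves the half-line of nonnegative integers to a half-line
    that differs from it by two points. *)
Lemma lmul_triple_commg (H : groupType) (h : H) :
  [~ [~ base H (reflection 0), base H (reflection 1)],
     fib_on nonneg_int (lmul h)]
    = fib_on first_two_int (lmul h).
Proof.
rewrite -(morphR (base H)) base_commR; apply: eq_fib => n.
rewrite reflection_commg /first_two_int /nonneg_int.
have -> : (n < 2)%R = ~~ (0 <= n - 2)%R by lia.
case: ifP; case: ifP => //= *; rewrite ?mulVg ?invg1 ?mul1g //; lia.
Qed.

(** * Triple commutators of differences of conjugates of one element *)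

Section OptionAction.
Variable A : groupType.

Definition opt_mul (a : A) : option A -> option A := omap (mul a).

Lemma opt_mulK (a b : A) : a * b = 1 -> cancel (opt_mul b) (opt_mul a).
Proof. by move=> ab [x|//]; rewrite /= mulgA ab mul1g. Qed.

Definition opt_act (a : A) : sym (option A) :=
  Sym (opt_mulK (mulVg a)) (opt_mulK (mulgV a)).

Lemma opt_actM : {morph opt_act : a b / a * b}.
Proof. by move=> a b; apply: symP => -[x|] //=; rewrite mulgA. Qed.

HB.instance Definition _ :=
  isMultiplicative.Build A (sym (option A)) opt_act opt_actM.

Definition opt_swap (b : A) (i : option A) : option A :=
  if i is Some c then (if c == b then None else i) else Some b.

Lemma opt_swapK b : involutive (opt_swap b).
Proof.
by case=> [c|] /=; rewrite ?eqxx //; case: eqP => [->|/eqP/negPf/= ->].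
Qed.

Definition opt_transposition b : sym (option A) :=
  Sym (opt_swapK b) (opt_swapK b).

Variable X : Type.

Definition at_unit : sym X -> sym (option A * X) := fib_on (pred1 (Some 1)).

HB.instance Definition _ := Multiplicative.on at_unit.

Variables (a : A) (d1 d2 d3 : sym X).
Hypothesis a_neq1 : a != 1.

Let x := base X (opt_act a).
Let y := x ^ base X (opt_transposition a^-1).

(** By definition [~ x, d] is x^-1 * x ^ d, which is the product of d and of a
    conjugate of d^-1.  The conjugate lives over the point that x sends to
    [Some 1], which is [Some a^-1] for [x] and [None] for [y]: [y] is conjugate
    to [x] by the transposition of these two points.  Hence the first two
    factors meet over [Some 1] only, and there both are free of errors. *)
Lemma at_unit_commg :
  [~ [~ [~ x, at_unit d1], [~ y, at_unit d2]], [~ x, at_unit d3]]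
    = at_unit [~ [~ d1, d2], d3].
Proof.
rewrite /y /x -(morphJ (base X)) !base_commR !fibR.
apply: eq_fib => -[c|] /=; last first.
  by rewrite !gsimp !comm1g.
have SomeE (u v : A) : (Some u == Some v) = (u == v) by [].
have aV1 : (a^-1 == 1) = false by rewrite invg_eq1 (negPf a_neq1).
rewrite !SomeE; have [->|c1] := eqVneq c 1.
  rewrite mulg1 (negPf a_neq1) (eq_sym 1) aV1 /= mulg1.
  by case: (a == a^-1); rewrite ?SomeE ?(negPf a_neq1) ?gsimp.
have [ac|_] := eqVneq (a * c) 1; last by rewrite !gsimp !comm1g.
by rewrite -(mulg1_eq ac) eqxx /= SomeE aV1 !gsimp commg1 comm1g.
Qed.

End OptionAction.

(** * Sparse sequences *)

Lemma greedy_sequence (T : choiceType) (bad : seq T -> seq T) :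
  infinite_set [set: T]%classic ->
  exists t : nat -> T, forall m, t m \notin bad (mkseq t m).
Proof.
move=> Tinf.
have next (s : seq T) : exists x : T, x \notin s.
  apply: contrapT => ns; apply: Tinf; apply/finite_seqP; exists s.
  apply/seteqP; split=> // x _ /=; apply: contrapT => /negP xs.
  by apply: ns; exists x.
pose pick s := sval (cid (next (bad s))).
pose prefix := fix prefix m :=
  if m is m'.+1 then rcons (prefix m') (pick (prefix m')) else [::].
exists (pick \o prefix) => m.
have -> : mkseq (pick \o prefix) m = prefix m.
  by elim: m => //= m IHm; rewrite mkseqS IHm.
exact: svalP (cid (next _)).
Qed.

(** A condition in the style of Sidon sets; p = q gives that t is injective. *)
Definition generic (B : groupType) (t : nat -> B) :=
  forall p q r m, p < m -> q < m -> r < m -> t m != t p * (t q)^-1 * t r.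

Definition separated (B : groupType) (F : seq B) (t : nat -> B) :=
  forall c k l, c \in F -> c != 1 -> t k != c * t l.

Lemma sparse_sequence (B : groupType) (F : seq B) :
  infinite_set [set: B]%classic ->
  exists2 t : nat -> B, generic t & separated F t.
Proof.
move=> Binf.
pose bad (s : seq B) :=
  [seq pq * r | pq <- [seq p * q^-1 | p <- s, q <- s], r <- s]
  ++ [seq c * p | c <- F, p <- s] ++ [seq c^-1 * p | c <- F, p <- s].
have [t tP] := greedy_sequence bad Binf.
have in_prefix k m : k < m -> t k \in mkseq t m.
  by move=> km; apply: map_f; rewrite mem_iota.
exists t.
  move=> p q r m /in_prefix tp /in_prefix tq /in_prefix tr.
  apply: contraNneq (tP m) => tm.
  rewrite mem_cat; apply/orP; left; rewrite {1}tm.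
  by apply: allpairs_f => //; apply: allpairs_f.
move=> c k l cF c1; apply/eqP => tkl.
have [kl|lk|kl] := ltngtP k l.
- case/negP: (tP l); rewrite /bad !mem_cat; apply/or3P; apply: Or33.
  rewrite -[t l](mulKg c) -tkl.
  by apply: (allpairs_f (fun c p => c^-1 * p)) => //; apply: in_prefix.
- case/negP: (tP k); rewrite /bad !mem_cat; apply/or3P; apply: Or32.
  by rewrite tkl; apply: allpairs_f => //; apply: in_prefix.
- by case/eqP: c1; apply: (mulIg (t l)); rewrite mul1g -{2}kl.
Qed.

Lemma generic_inj (B : groupType) (t : nat -> B) : generic t -> injective t.
Proof.
move=> tg k l; wlog lk : k l / k <= l.
  by move=> th tkl; have [/th->|/ltnW/th->] := leqP k l.
move: lk; rewrite leq_eqVlt => /predU1P[//|kl] tkl.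
by case/eqP: (tg k k k l kl kl kl); rewrite mulgV mul1g.
Qed.

(** Suppose that b <> 1.  In the equations
    t i^-1 * t k = t j^-1 * t l = t s^-1 * t r, consider the largest of the six
    indices.  As i, j < s, it is one of k, l, r, s, and as k, l, r are distinct
    one can choose two of the three quotients in which it occurs exactly once.
    Solving for that term contradicts genericity.  With the quotients for i and
    j alone this fails: the largest index may occur twice, as in i = l. *)
Lemma generic_translate (B : groupType) (t : nat -> B) (b : B) i j s k l r :
  generic t -> i != j -> i < s -> j < s ->
  t i * b = t k -> t j * b = t l -> t s * b = t r -> b = 1.
Proof.
move=> tg ij is_ js tik tjl tsr; apply: contrapT => /eqP b1.
have t_inj := generic_inj tg.
(* The largest index is an end point k1 of the translation by b. *)
have forth i1 k1 i2 k2 : t i1 * b = t k1 -> t i2 * b = t k2 ->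
    i1 < k1 -> i2 < k1 -> k2 < k1 -> False.
  move=> e1 e2 lt1 lt2 lt3; case/eqP: (tg i1 i2 k2 k1 lt1 lt2 lt3).
  by rewrite -e1 -e2 -mulgA mulKg.
(* The largest index is a starting point i1. *)
have back i1 k1 i2 k2 : t i1 * b = t k1 -> t i2 * b = t k2 ->
    k1 < i1 -> i2 < i1 -> k2 < i1 -> False.
  move=> e1 e2 lt1 lt2 lt3; case/eqP: (tg k1 k2 i2 i1 lt1 lt3 lt2).
  by rewrite -e1 -e2 invgM -!mulgA mulVg mulg1 mulgV mulg1.
have moved i1 k1 : t i1 * b = t k1 -> i1 != k1.
  move=> e; apply: contraNneq b1 => ik.
  by rewrite -[b](mulKg (t i1)) e ik mulVg.
have distinct i1 k1 i2 k2 : t i1 * b = t k1 -> t i2 * b = t k2 ->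
    i1 != i2 -> k1 != k2.
  move=> e1 e2; apply: contraNneq => k12.
  by apply/eqP/t_inj/(mulIg b); rewrite e1 e2 k12.
have := moved _ _ tik; have := moved _ _ tjl; have := moved _ _ tsr.
have := distinct _ _ _ _ tik tjl ij.
have := distinct _ _ _ _ tik tsr; have := distinct _ _ _ _ tjl tsr.
have := forth _ _ _ _ tik tjl; have := forth _ _ _ _ tjl tik.
have := forth _ _ _ _ tsr tik; have := back _ _ _ _ tsr tik.
have := back _ _ _ _ tsr tjl.
lia.
Qed.

(** * Lifting from the wreath product *)

Lemma prodg_perm (K : monoidType) (T : eqType) (F : T -> K) (s1 s2 : seq T) :
  {in s1 &, forall x y, commute (F x) (F y)} -> perm_eq s1 s2 ->
  \prod_(x <- s1) F x = \prod_(x <- s2) F x.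
Proof.
elim: s1 s2 => [|x s1 IHs] s2 comm p12.
  by move: p12; rewrite perm_sym => /perm_nilP->.
have xs2 : x \in s2 by rewrite -(perm_mem p12) mem_head.
case/splitPr: xs2 p12 => p1 p2.
rewrite perm_sym -cat1s perm_catCA /= perm_cons perm_sym => p12.
have comm1 : {in s1 &, forall x y, commute (F x) (F y)}.
  by move=> y z ys zs; apply: comm; rewrite inE ?ys ?zs orbT.
rewrite big_cons (IHs _ comm1 p12) !big_cat /= big_cons !mulgA; congr (_ * _).
rewrite big_seq; apply: commute_prod => y yp1.
apply: comm; first exact: mem_head.
by rewrite inE (perm_mem p12) mem_cat yp1 orbT.
Qed.

Section PartialLift.
Variables A B K : groupType.

(** The defining relations of the wreath product that involve only translations
    by elements of F. *)
Definition far_commuting (F : seq B) (alpha : A -> K) (beta : B -> K) :=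
  forall c, c \in F -> c != 1 ->
  forall a a', commute (alpha a) (alpha a' ^ beta c).

Section Lift.
Variables (alpha : {multiplicative A -> K}) (beta : {multiplicative B -> K}).
Implicit Types (s : seq B) (f g : direct_sum A B) (u v w : wreath A B).

Definition factor g x := alpha (g x) ^ beta x^-1.
Definition lift_base s g := \prod_(x <- s) factor g x.

(** The morphism A wr B -> K that extends alpha and beta would have to be given
    by this formula.  The order of the factors is the enumeration of the finite
    support; it matters unless they commute. *)
Definition wr_lift w :=
  lift_base (finsupp (wr_base w)) (wr_base w) * beta (wr_top w).

(** The factors at x and y of the lift commute when the relations for y^-1 * x
    hold. *)
Definition differences s := [seq y^-1 * x | x <- s, y <- s].

Lemma far_commuting_sub s s' : {subset s' <= s} ->
  far_commuting (differences s) alpha beta ->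
  far_commuting (differences s') alpha beta.
Proof.
move=> ss' far _ /allpairsP[[x y] /= [/ss' xs /ss' ys ->]]; apply: far.
exact: (allpairs_f (fun x y => y^-1 * x)).
Qed.

Lemma factor_commute s f g : far_commuting (differences s) alpha beta ->
  {in s &, forall x y, x != y -> commute (factor f x) (factor g y)}.
Proof.
move=> far x y xs ys xy; rewrite /factor.
have -> : beta y^-1 = beta (y^-1 * x) * beta x^-1 by rewrite -gmulfM mulgK.
rewrite conjgM; apply/commuteJ/far.
  exact: (allpairs_f (fun x y => y^-1 * x)).
by rewrite mulg_eq1 eqg_inv eq_sym.
Qed.

Lemma factorM f g x : factor (f * g) x = factor f x * factor g x.
Proof. by rewrite /factor dsum_mulE gmulfM conjMg. Qed.

Lemma factor_shift b g x :
  factor (dsum_shift b g) (b * x) = factor g x ^ beta b^-1.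
Proof. by rewrite /factor dsum_shiftE mulKg invgM gmulfM conjgM. Qed.

Lemma lift_baseM s f g : uniq s -> far_commuting (differences s) alpha beta ->
  lift_base s (f * g) = lift_base s f * lift_base s g.
Proof.
move=> us far; have comm := factor_commute _ _ far.
rewrite /lift_base; elim: s us {far} comm => [|x s IHs] /=.
  by rewrite !big_nil mulg1.
case/andP=> xs us comm; rewrite !big_cons IHs //; last first.
  by move=> f' g' y z ys zs; apply: comm; rewrite inE ?ys ?zs orbT.
have swap a b p q : commute b p -> a * b * (p * q) = a * p * (b * q) :> K.
  by move=> bp; rewrite -!mulgA [b * (p * q)]mulgA bp !mulgA.
rewrite factorM swap // big_seq; apply: commute_prod => y ys.
apply: comm; rewrite ?inE ?eqxx ?ys ?orbT //.
by apply: contraNneq xs => ->.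
Qed.

Lemma lift_base_finsupp s g : uniq s -> {subset finsupp g <= s} ->
  far_commuting (differences s) alpha beta ->
  lift_base s g = lift_base (finsupp g) g.
Proof.
move=> us gs far; rewrite /lift_base.
have -> : \prod_(x <- s) factor g x =
    \prod_(x <- [seq x <- s | x \in finsupp g]) factor g x.
  rewrite big_filter [RHS]big_mkcond; apply: eq_bigr => x _.
  by rewrite /factor; case: finsuppP => // _; rewrite morph1 conj1g.
apply: prodg_perm.
  move=> x y; rewrite !mem_filter => /andP[_ xs] /andP[_ ys].
  have [->|] := eqVneq x y; first exact: commute_refl.
  exact: (factor_commute _ _ far).
apply: uniq_perm; rewrite ?filter_uniq ?fset_uniq // => x.
by rewrite mem_filter andb_idr // => /gs.
Qed.

Lemma lift_base_shift b s g :
  lift_base [seq b * x | x <- s] (dsum_shift b g) = lift_base s g ^ beta b^-1.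
Proof.
rewrite /lift_base big_map conjg_prod; apply: eq_bigr => x _.
exact: factor_shift.
Qed.

(** Over a finite set s that contains all the supports involved, relations for
    the differences of s suffice to reorder and merge the factors. *)
Lemma wr_liftM u v :
  far_commuting (differences (finsupp (wr_base u) `|`
    finsupp (dsum_shift (wr_top u) (wr_base v)))%fset) alpha beta ->
  wr_lift (u * v) = wr_lift u * wr_lift v.
Proof.
case: u v => [f b] [g c] /=; set s := (_ `|` _)%fset => far.
have sub_f : {subset finsupp f <= s} by move=> x; rewrite inE => ->.
have sub_g : {subset finsupp (dsum_shift b g) <= s}.
  by move=> x; rewrite inE orbC => ->.
have sub_fg : {subset finsupp (f * dsum_shift b g) <= s}.
  move=> x; rewrite !mem_finsupp dsum_mulE; apply: contraR.
  rewrite inE negb_or !mem_finsupp !negbK => /andP[/eqP-> /eqP->].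
  by rewrite mulg1.
have us : uniq s by apply: fset_uniq.
rewrite /wr_lift /= gmulfM -(lift_base_finsupp us sub_fg far) lift_baseM //.
rewrite (lift_base_finsupp us sub_f far) (lift_base_finsupp us sub_g far).
have -> : lift_base (finsupp (dsum_shift b g)) (dsum_shift b g)
    = lift_base (finsupp g) g ^ beta b^-1.
  have mem_map x :
      (x \in [seq b * y | y <- finsupp g]) = (x \in finsupp (dsum_shift b g)).
    rewrite -[x](mulVKg b) mem_map; last exact: mulgI.
    by rewrite !mem_finsupp dsum_shiftE mulKg.
  rewrite -lift_base_shift lift_base_finsupp //.
  - by rewrite map_inj_uniq ?fset_uniq //; apply: mulgI.
  - by move=> x; rewrite mem_map.
  - by apply: far_commuting_sub far => x; rewrite mem_map; apply: sub_g.
by rewrite /conjg morphV invgK -!mulgA mulKg.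
Qed.

Lemma wr_lift1 : wr_lift 1 = 1.
Proof. by rewrite /wr_lift /lift_base finsupp0 big_nil mul1g morph1. Qed.

Lemma wr_lift_top b : wr_lift (Wreath 1 b) = beta b.
Proof. by rewrite /wr_lift /lift_base finsupp0 big_nil mul1g. Qed.

End Lift.
End PartialLift.

(** * Finitely presented groups *)

Section FreeMorphism.
Variables (T : choiceType) (K : groupType) (phi : T -> K).

Definition free_letter (a : T * bool) : free_group T :=
  @FreeGroup T [:: a] erefl.

(** Stripping the first letter of a reduced word leaves a reduced word. *)
Lemma free_group_ind (P : free_group T -> Prop) :
  P 1 -> (forall a u, P u -> P (free_letter a * u)) -> forall u, P u.
Proof.
move=> P1 PM [w rw]; elim: w rw => [|a w IHw] rw.
  by have -> : FreeGroup rw = 1 by apply: val_inj.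
have rw' : reduced w by apply: path_sorted rw.
have -> : FreeGroup rw = free_letter a * FreeGroup rw'; last exact: PM.
apply: val_inj; rewrite /= /word_mul /=.
by case: w rw {IHw rw'} => //= b w /andP[/negPf->].
Qed.

Definition letter_value (a : T * bool) : K :=
  if a.2 then (phi a.1)^-1 else phi a.1.

Definition free_morph (u : free_group T) : K :=
  foldr (fun a k => letter_value a * k) 1 (free_word u).

Lemma letter_value_inv a : letter_value (letter_inv a) = (letter_value a)^-1.
Proof. by case: a => x [] //=; rewrite /letter_value /= invgK. Qed.

Lemma free_morphM : {morph free_morph : u v / u * v}.
Proof.
move=> [u ru] [v rv]; rewrite /free_morph /=; elim: u {ru} => [|a u IHu] /=.
  by rewrite mul1g.
rewrite -mulgA -IHu; case: (word_mul u v) => //= b w; case: eqP => // ->.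
by rewrite letter_value_inv mulVKg.
Qed.

HB.instance Definition _ :=
  isMultiplicative.Build (free_group T) K free_morph free_morphM.

Lemma free_morph_letter a : free_morph (free_letter a) = letter_value a.
Proof. exact: mulg1. Qed.

End FreeMorphism.

Lemma free_letterV (T : choiceType) (x : T) :
  free_letter (x, true) = (free_letter (x, false))^-1.
Proof. exact: val_inj. Qed.

Lemma normal_closure_sub_ker (G K : groupType)
    (h : {multiplicative G -> K}) (S : set G) :
  (forall x, S x -> h x = 1) -> forall x, normal_closure S x -> h x = 1.
Proof.
move=> hS x; apply: (smallest_sub (X := [set y | h y = 1]%classic)) => //.
split=> /=.
- exact: morph1.
- by move=> y z hy hz; rewrite gmulfM hy hz mulg1.
- by move=> y hy; rewrite morphV hy invg1.
- by move=> y z hy; rewrite morphJ hy conj1g.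
Qed.

Lemma morph_factor (E G K : groupType) (f : {multiplicative E -> G})
    (h : {multiplicative E -> K}) :
  surjective f -> (forall u, f u = 1 -> h u = 1) ->
  exists k : {multiplicative G -> K}, forall u, k (f u) = h u.
Proof.
move=> fsurj ker; pose k g := h (sval (cid (fsurj g))).
have kf u : k (f u) = h u.
  rewrite /k; case: cid => v /= fv; apply/divg1_eq.
  by rewrite -morphV -gmulfM ker // gmulfM morphV fv mulgV.
have kM : {morph k : x y / x * y}.
  move=> x y; have [[u <-] [v <-]] := (fsurj x, fsurj y).
  by rewrite -gmulfM !kf gmulfM.
pose kMult := isMultiplicative.Build G K k kM.
pose k' : {multiplicative G -> K} := HB.pack k kMult.
by exists k'.
Qed.

Section LiftPresentation.
Variables A B G K : groupType.

(** Truth for all pairs that satisfy sufficiently many of the relations of the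
    wreath product. *)
Definition eventually
    (P : {multiplicative A -> K} -> {multiplicative B -> K} -> Prop) :=
  exists F : seq B, forall (alpha : {multiplicative A -> K})
    (beta : {multiplicative B -> K}),
  far_commuting F alpha beta -> P alpha beta.

Lemma eventually_and P Q : eventually P -> eventually Q ->
  eventually (fun alpha beta => P alpha beta /\ Q alpha beta).
Proof.
move=> [F FP] [F' F'P]; exists (F ++ F') => alpha beta far.
split; [apply: FP | apply: F'P] => c cF; apply: far;
  by rewrite mem_cat cF ?orbT.
Qed.

Lemma eventually_sub
    (P Q : {multiplicative A -> K} -> {multiplicative B -> K} -> Prop) :
  (forall alpha beta, P alpha beta -> Q alpha beta) ->
  eventually P -> eventually Q.
Proof. by move=> PQ [F FP]; exists F => alpha beta /FP/PQ. Qed.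

Lemma eventually_all (T : eqType) (s : seq T) P :
  (forall x, eventually (P x)) ->
  eventually (fun alpha beta => forall x, x \in s -> P x alpha beta).
Proof.
move=> evP; elim: s => [|x s IHs]; first by exists [::].
apply: eventually_sub (eventually_and (evP x) IHs) => alpha beta [Px Ps] y.
by rewrite inE => /predU1P[->|/Ps].
Qed.

Lemma wr_lift_single (alpha : {multiplicative A -> K})
    (beta : {multiplicative B -> K}) a :
  wr_lift alpha beta (Wreath [fsfun x in [fset 1]%fset => a] 1) = alpha a.
Proof.
rewrite /wr_lift morph1 mulg1 /= -(@lift_base_finsupp _ _ _ _ _ [:: 1]) //.
- rewrite /lift_base big_seq1 /factor fsfunE in_fset1 eqxx.
  by rewrite invg1 morph1 conjg1.
- move=> x; rewrite mem_finsupp fsfunE in_fset1 inE.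
  by case: ifP; rewrite ?eqxx.
- by move=> c; rewrite inE invg1 mulg1 => ->.
Qed.

(** The generators of G are sent to the lifts of their images in A wr B.  For
    each word u, the product of the lifts of its letters is the lift of its
    value, eventually; applied to the relators, this yields a morphism on G.
    Applied to words representing the element a placed at 1, and the top
    components of the generators, it shows that the image contains alpha(a) and,
    since these top components generate B, all of beta(B). *)
Theorem finitely_presented_lift (p : {multiplicative G -> wreath A B}) (a : A) :
  finitely_presented G -> surjective p ->
  eventually (fun alpha beta => exists theta : {multiplicative G -> K},
    (exists g, theta g = alpha a) /\ forall b, exists g, theta g = beta b).
Proof.
move=> [n [rels [f [fsurj kerf]]]] psurj.
pose gen i := p (f (free_letter (i, false))).
pose h (alpha : {multiplicative A -> K}) (beta : {multiplicative B -> K}) :=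
  free_morph (fun i => wr_lift alpha beta (gen i)).
have pre w : exists u, p (f u) = w.
  by have [g <-] := psurj w; have [u <-] := fsurj g; exists u.
have h_lift u : eventually (fun alpha beta =>
    h alpha beta u = wr_lift alpha beta (p (f u))).
  elim/free_group_ind: u => [|[i e] u IHu].
    by exists [::] => alpha beta _; rewrite !morph1 wr_lift1.
  have mul v w : eventually (fun alpha beta => wr_lift alpha beta (v * w) =
      wr_lift alpha beta v * wr_lift alpha beta w).
    by eexists => alpha beta; apply: wr_liftM.
  have letter : eventually (fun alpha beta =>
      h alpha beta (free_letter (i, e)) =
        wr_lift alpha beta (p (f (free_letter (i, e))))).
    case: e; last by exists [::] => alpha beta _; rewrite /h free_morph_letter.
    apply: eventually_sub (mul (gen i) (gen i)^-1) => alpha beta.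
    rewrite mulgV wr_lift1 => /esym/mulg1_eq genV.
    by rewrite /h free_morph_letter free_letterV !morphV -genV.
  apply: eventually_sub (eventually_and letter (eventually_and IHu
    (mul (p (f (free_letter (i, e)))) (p (f u))))).
  by move=> alpha beta [hl [hu lM]]; rewrite !gmulfM lM -hl -hu -gmulfM.
have [ua fua] := pre (Wreath [fsfun x in [fset 1]%fset => a] 1).
have [ub fub] : exists ub : 'I_n -> free_group 'I_n,
    forall i, p (f (ub i)) = Wreath 1 (wr_top (gen i)).
  exists (fun i => sval (cid (pre (Wreath 1 (wr_top (gen i)))))) => i.
  by case: cid.
apply: eventually_sub (eventually_and (eventually_all rels h_lift)
  (eventually_and (h_lift ua)
    (eventually_all (enum 'I_n) (fun i => h_lift (ub i))))).
move=> alpha beta [h_rels [h_ua h_ub]].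
have [theta thetaf] : exists theta : {multiplicative G -> K},
    forall u, theta (f u) = h alpha beta u.
  apply: morph_factor => // u fu.
  apply: (@normal_closure_sub_ker _ _ (h alpha beta) [set` rels]%classic).
    move=> r rrels; have /= fr : [set w | f w = 1]%classic r.
      by rewrite kerf; apply: sub_gen_smallest.
    by apply: (etrans (h_rels r rrels)); rewrite fr morph1 wr_lift1.
  by rewrite -kerf.
exists theta; split.
  by exists (f ua); rewrite thetaf h_ua fua wr_lift_single.
suff top u : exists g, theta g = beta (wr_top (p (f u))).
  by move=> b; have [u fu] := pre (Wreath 1 b); have := top u; rewrite fu.
elim/free_group_ind: u => [|[i e] u [g thetag]].
  by exists 1; rewrite !morph1.
have topM v w : wr_top (p (f (v * w))) = wr_top (p (f v)) * wr_top (p (f w)).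
  by rewrite !gmulfM.
have topi : theta (f (ub i)) = beta (wr_top (gen i)).
  by rewrite thetaf h_ub ?mem_enum // fub wr_lift_top.
exists (f (if e then (ub i)^-1 else ub i) * g).
rewrite topM !gmulfM thetag; congr (_ * _); case: e => //.
by rewrite free_letterV !morphV topi -morphV.
Qed.

End LiftPresentation.

(** * Images and quotients *)

Section Range.
Variables (G K : groupType) (theta : {multiplicative G -> K}).

Definition in_range : pred K := fun x => `[< exists g, theta g = x >].

Record morph_range :=
  MorphRange { range_val : K; range_valP : in_range range_val }.

HB.instance Definition _ := [isSub for range_val].
HB.instance Definition _ := [Choice of morph_range by <:].

Lemma in_range_closed : group_closed in_range.
Proof.
split=> [|_ _ /asboolP[g <-] /asboolP[h <-]]; apply/asboolP.
  by exists 1; rewrite morph1.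
by exists (g * h^-1); rewrite gmulfM morphV.
Qed.

HB.instance Definition _ :=
  SubChoice_isSubGroup.Build K in_range morph_range in_range_closed.

Lemma quotient_embedding (H : groupType) (iota : {multiplicative H -> K}) :
  injective iota -> (forall h, exists g, theta g = iota h) ->
  exists2 Q : groupType, is_quotient G Q & is_subgroup H Q.
Proof.
move=> iota_inj sub.
have theta_in g : in_range (theta g) by apply/asboolP; exists g.
have iota_in h : in_range (iota h) by apply/asboolP.
pose p g := MorphRange (theta_in g); pose i h := MorphRange (iota_in h).
have pM : {morph p : x y / x * y}.
  by move=> x y; apply: val_inj; rewrite valM /= gmulfM.
have iM : {morph i : x y / x * y}.
  by move=> x y; apply: val_inj; rewrite valM /= gmulfM.
pose pMult := isMultiplicative.Build G morph_range p pM.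
pose iMult := isMultiplicative.Build H morph_range i iM.
pose p' : {multiplicative G -> morph_range} := HB.pack p pMult.
pose i' : {multiplicative H -> morph_range} := HB.pack i iMult.
exists morph_range.
  by exists p' => -[x xP]; have /asboolP[g gx] := xP; exists g; apply: val_inj.
by exists i' => x y /(congr1 val) /=; apply: iota_inj.
Qed.

End Range.

(** * Isolating one coordinate *)

Section Coordinates.
Variables (B : groupType) (X : Type) (t : nat -> B).
Hypothesis t_generic : generic t.
Implicit Types (f : nat -> sym X) (b : B).

Definition place f b : sym X :=
  if pselect (exists m, t m = b) is left e then f (sval (cid e)) else 1.

Lemma placeE f m : place f (t m) = f m.
Proof.
rewrite /place; case: pselect => [e|[]]; last by exists m.
by case: cid => n /= /(generic_inj t_generic) ->.
Qed.

Lemma placeP b : (exists m, t m = b) \/ forall f, place f b = 1.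
Proof. by rewrite /place; case: pselect => [|_]; [left | right]. Qed.

Definition spread f : sym (B * X) := fib (place f).

Lemma spreadM f g : spread f * spread g = spread (fun m => f m * g m).
Proof.
rewrite /spread fibM; apply: eq_fib => b.
by have [[m <-]|e] := placeP b; rewrite ?placeE // !e mulg1.
Qed.

(** No point of B carries nontrivial values of both permutations, because c
    moves the set of values of t off itself. *)
Lemma spread_far_commute F f g c : separated F t -> c \in F -> c != 1 ->
  commute (spread f) (spread g ^ base X (lmul c)).
Proof.
move=> tF cF c1; rewrite fibJ; apply: fib_commute => b /=.
have [[k tk]|->] := placeP b; last exact/commute_sym/commute1.
have [[l tl]|->] := placeP (c * b); last exact: commute1.
by case/eqP: (tF c l k cF c1); rewrite tk.
Qed.

Definition translate f i := spread f ^ base X (lmul (t i)).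

(** Over b, the translate of index i takes the value placed at t i * b.  For the
    commutator to be nontrivial over b, each of the three entries has to be, so
    that b moves one t i, one t j and one t s to values of t. *)
Lemma translate_commg f i0 i1 j0 j1 s0 s1 :
  {in [:: i0; i1] & [:: j0; j1], forall i j, i != j} ->
  {in i0 :: i1 :: [:: j0; j1] & [:: s0; s1], forall i s, i < s} ->
  let c := translate f in
  [~ [~ (c i0)^-1 * c i1, (c j0)^-1 * c j1], (c s0)^-1 * c s1]
    = fib_on (pred1 1)
        [~ [~ (f i0)^-1 * f i1, (f j0)^-1 * f j1], (f s0)^-1 * f s1].
Proof.
move=> ij ls /=; rewrite /translate !fibJ !fibV !fibM !fibR.
apply: eq_fib => b /=.
have [->|b1] := eqVneq b 1; first by rewrite !mulg1 !placeE.
pose v i0 i1 := (place f (t i0 * b))^-1 * place f (t i1 * b).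
have vP k l : v k l = 1 \/ exists2 i, i \in [:: k; l] & exists m, t i * b = t m.
  rewrite /v; have [[m tm]|->] := placeP (t k * b).
    by right; exists k; rewrite ?mem_head //; exists m.
  have [[m tm]|->] := placeP (t l * b); last by left; rewrite invg1 mulg1.
  by right; exists l; rewrite ?inE ?eqxx ?orbT //; exists m.
rewrite -/(v i0 i1) -/(v j0 j1) -/(v s0 s1).
have [->|[i ii [k tk]]] := vP i0 i1; first by rewrite !comm1g.
have [->|[j jj [l tl]]] := vP j0 j1; first by rewrite commg1 comm1g.
have [->|[s ss [r tr]]] := vP s0 s1; first by rewrite commg1.
case/eqP: b1.
apply: (generic_translate t_generic (ij i j ii jj) _ _ tk tl tr);
  apply: ls => //.
  by move: ii; rewrite !inE => /orP[]->; rewrite ?orbT.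
by move: jj; rewrite !inE => /orP[]->; rewrite ?orbT.
Qed.

End Coordinates.

Lemma countable_enum (H : groupType) : countable [set: H]%classic ->
  exists e : nat -> H, forall h, exists n, e n = h.
Proof.
move=> /countable_injP[f finj].
exists (fun n =>
  if pselect (exists h, f h = n) is left e then sval (cid e) else 1) => h.
exists (f h); case: pselect => [e|[]]; last by exists h.
by case: cid => h' /= /finj; apply; rewrite inE.
Qed.

(** * The configuration, and the theorem *)

Section Configuration.
Variables (A B H : groupType) (a : A) (t : nat -> B) (e : nat -> H).
Hypotheses (a_neq1 : a != 1) (t_generic : generic t).

Local Notation Y := (int * H)%type.
Local Notation X := (option A * Y)%type.

(** Conjugating by [conjugator m] the action of A on [option A] gives the m-th
    morphism A -> Sym(X).  Indices 0 and 1 give [x] and [x ^ d1] in the notation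
    of [at_unit_commg], indices 2 and 3 give [y] and [y ^ d2], and indices 4 and
    n + 5 give [x] and [x ^ d3], where d3 depends on the n-th element of H.  The
    repetition of [x] at 4 is needed since the last entry of the triple
    commutator must only involve indices larger than those of the first two. *)
Definition conjugator (m : nat) : sym X :=
  match m with
  | 0 => 1
  | 1 => at_unit A (base H (reflection 0))
  | 2 => base Y (opt_transposition a^-1)
  | 3 => base Y (opt_transposition a^-1) * at_unit A (base H (reflection 1))
  | 4 => 1
  | n.+4.+1 => at_unit A (fib_on nonneg_int (lmul (e n)))
  end.

Definition coordinate_morph m : {multiplicative A -> sym X} :=
  conj_morph (base Y \o @opt_act A) (conjugator m).

Definition lamp_morph (x : A) : sym (B * X) :=
  spread t (fun m => coordinate_morph m x).

Lemma lamp_morphM : {morph lamp_morph : x y / x * y}.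
Proof.
move=> x y; rewrite /lamp_morph spreadM //; congr (spread t _).
by apply/funext => m; rewrite gmulfM.
Qed.

HB.instance Definition _ :=
  isMultiplicative.Build A (sym (B * X)) lamp_morph lamp_morphM.

Definition top_morph : {multiplicative B -> sym (B * X)} := base X \o @lmul B.

Definition embedding : {multiplicative H -> sym (B * X)} :=
  fib_on (pred1 1) \o (@at_unit A Y \o (fib_on first_two_int \o @lmul H)).

Lemma embedding_inj : injective embedding.
Proof.
move=> x y /(@fib_on_inj _ _ (pred1 (1 : B)) 1 (eqxx _)).
move=> /(@fib_on_inj _ _ (pred1 (Some (1 : A))) (Some 1) (eqxx _)).
by move=> /(@fib_on_inj _ _ first_two_int 0%R isT) /lmul_inj.
Qed.

Lemma far_commuting_config F :
  separated F t -> far_commuting F lamp_morph top_morph.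
Proof. by move=> tF c cF c1 x y; apply: (spread_far_commute _ _ tF cF c1). Qed.

Lemma embedding_commg n : let c i := lamp_morph a ^ top_morph (t i) in
  embedding (e n) =
    [~ [~ (c 0%N)^-1 * c 1%N, (c 2)^-1 * c 3], (c 4)^-1 * c n.+4.+1].
Proof.
transitivity (fib_on (pred1 (1 : B)) (at_unit A [~ [~ base H (reflection 0),
    base H (reflection 1)], fib_on nonneg_int (lmul (e n))])).
  by rewrite lmul_triple_commg.
rewrite -(at_unit_commg _ _ _ a_neq1).
have := translate_commg t_generic (fun m => coordinate_morph m a)
  (i0 := 0%N) (i1 := 1%N) (j0 := 2) (j1 := 3) (s0 := 4) (s1 := n.+4.+1).
move=> /= ->.
- by rewrite /conj_morph /= conjg1 conjgM.
- by move=> i j; rewrite !inE => /orP[]/eqP-> /orP[]/eqP->.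
- by move=> i s; rewrite !inE => /or4P[]/eqP-> /orP[]/eqP->.
Qed.

End Configuration.

Theorem corollary1p3 (A B G : groupType)
    (A_nontrivial : exists a : A, a <> 1%g)
    (B_infinite : infinite_set [set: B]%classic)
    (G_fp : finitely_presented G)
    (G_wr : is_quotient G (wreath A B)) :
  SQ_universal G.
Proof.
move=> H /countable_enum[e eP].
have [a /eqP a1] := A_nontrivial; have [p psurj] := G_wr.
have [F FP] :=
  finitely_presented_lift (sym (B * (option A * (int * H)))) a G_fp psurj.
have [t tg tF] := sparse_sequence F B_infinite.
have [theta [[ga thetaa] theta_beta]] :=
  FP (lamp_morph a t e) (top_morph A B H) (far_commuting_config a e tF).
apply: (@quotient_embedding _ _ theta _ _ (@embedding_inj A B H)) => h.
have [n <-] := eP h; rewrite (embedding_commg e a1 tg).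
have [gb gbP] : exists gb, forall i, theta (gb i) = top_morph A B H (t i).
  by exists (fun i => sval (cid (theta_beta (t i)))) => i; case: cid.
pose c i := ga ^ gb i.
exists [~ [~ (c 0%N)^-1 * c 1%N, (c 2)^-1 * c 3], (c 4)^-1 * c n.+4.+1].
by rewrite !morphR !gmulfM !morphV !morphJ thetaa !gbP.
Qed.
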